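(* Let $n\ge 2$. Galkin's lower bound conjecture holds for the $(2n-1)$-dimensional quadric $\mathrm{OG}$; that is, with $c_1=(2n-1)\tau_1$ the anticanonical class of $\mathrm{OG}$, \[ \mathrm{FPdim}(c_1)=\mathrm{FPdim}\big((2n-1)\tau_1\big)\ \ge\ \dim_{\mathbb{C}}\mathrm{OG}+1=2n . \]
   Context: Let $n\ge 2$ and let $\mathrm{OG}=\mathrm{OG}(1,2n+1)\subset\mathbb{P}(\mathbb{C}^{2n+1})$ be the $(2n-1)$-dimensional quadric of isotropic lines through the origin in $\mathbb{C}^{2n+1}$ for the symmetric form $(a,b)=\sum_{i=1}^{2n+1}a_i b_{2n+2-i}$; equivalently, the zero locus of $v_{n+1}^2+2\sum_{i=1}^n v_iv_{2n+2-i}$. For $0\le p\le n-1$ let $X(p)=\mathrm{OG}\cap\{v_1=\dots=v_p=0\}$ and for $n\le p\le 2n-1$ let $X(p)=\mathrm{OG}\cap\{v_1=\dots=v_{p+1}=0\}$; these are the Schubert varieties, $X(p)$ has codimension $p$ in $\mathrm{OG}$, and $\tau_p:=[X(p)]$ is its Schubert class. The Poincaré dual of $\tau_j$ is $\tau_{2n-1-j}$. The anticanonical class is $c_1:=c_1(-K_{\mathrm{OG}})=(2n-1)\tau_1\in H^2(\mathrm{OG})$, where $K_{\mathrm{OG}}$ is the canonical bundle, and $\dim_{\mathbb{C}}\mathrm{OG}=2n-1$. The (small) quantum cohomology ring $(\mathrm{QH}^*(\mathrm{OG}),\star)$ is the graded commutative associative $\mathbb{Z}[q]$-algebra with $\mathbb{Z}[q]$-basis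 $\tau_0,\dots,\tau_{2n-1}$, $\deg\tau_p=p$, $\deg q=2n-1$, and unit $\tau_0$, with product $\tau_p\star\tau_i=\sum_{j,d_0\ge 0}c_{p,i}^{j,d_0}q^{d_0}\tau_j$, where $c_{p,i}^{j,d_0}$ is the Gromov–Witten invariant enumerating degree $d_0$ rational curves meeting general translates of $X(p)$, $X(i)$, $X(2n-1-j)$. It satisfies the known quantum Chevalley formula: $\tau_1\star\tau_p=\tau_{p+1}$ for $0\le p\le n-2$; $\tau_1\star\tau_{n-1}=2\tau_n$; $\tau_1\star\tau_p=\tau_{p+1}$ for $n\le p\le 2n-3$; $\tau_1\star\tau_{2n-2}=\tau_{2n-1}+q\tau_0$; $\tau_1\star\tau_{2n-1}=q\tau_1$. Together with associativity and the unit $\tau_0$, this determines the product. $H^\bullet(\mathrm{OG})$ denotes the specialization of $\mathrm{QH}^*(\mathrm{OG})$ at $q=1$, regarded as a $2n$-dimensional complex vector space with basis $\tau_0,\dots,\tau_{2n-1}$. For a class $x$, $A(x)$ is the endomorphism $y\mapsto(x\star y)|_{q=1}$ of $H^\bullet(\mathrm{OG})$, and $\mathrm{FPdim}(x):=\max\{|\delta|:\delta\text{ is an eigenvalue of }A(x)\}$. *)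

(* Defs.v *)
(* The complex numbers are R[i], for an arbitrary R : realType. *)
From mathcomp Require Import all_boot all_order all_algebra.
From mathcomp Require Import all_classical all_reals.
From mathcomp Require Import complex.
From mathcomp Require mpoly.

Set Implicit Arguments.
Unset Strict Implicit.
Unset Printing Implicit Defensive.

Import Order.TTheory GRing.Theory Num.Theory.
Local Open Scope classical_set_scope.
Local Open Scope ring_scope.
Local Open Scope card_scope.

Definition dim_OG (n : nat) : nat := (2 * n - 1)%N.

Section Geometry.
Variables (R : realType) (n : nat).
Local Notation C := R[i].
Local Notation N := (2 * n).+1.

(* Coordinates are numbered from 0, so that v_{i+1} is [v 0 i] and
   [rev_ord] is i |-> 2n+2-i in the 1-based numbering. *)
Definition bform (a b : 'rV[C]_N) : C := \sum_(i < N) a 0 i * b 0 (rev_ord i).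

(* Subvarieties of the projective space are given by the nonzero vectors of
   their affine cones. *)
Definition OG : set 'rV[C]_N := [set v | v != 0 /\ bform v v = 0].

Definition schubert (p : nat) : set 'rV[C]_N :=
  [set v | OG v /\
     forall i : 'I_N, (i < (if p < n then p else p.+1))%N -> v 0 i = 0].

Definition SO : set 'M[C]_N :=
  [set g | (forall a b, bform (a *m g) (b *m g) = bform a b) /\ \det g = 1].

Definition translate (g : 'M[C]_N) (X : set 'rV[C]_N) : set 'rV[C]_N :=
  [set v *m g | v in X].

(* The matrix a encodes [s : t] |-> \sum_k s^(d-k) t^k (row k a). *)
Definition curve_eval (d : nat) (a : 'M[C]_(d.+1, N)) (s t : C) : 'rV[C]_N :=
  \sum_(k < d.+1) (s ^+ (d - k) * t ^+ k) *: row k a.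

(* Morphisms P^1 -> OG of degree d. As the forms have no common zero, two
   matrices define the same morphism iff they are proportional. *)
Definition is_curve (d : nat) (a : 'M[C]_(d.+1, N)) : Prop :=
  forall s t : C, (s, t) != (0, 0) -> OG (curve_eval a s t).

Definition same_curve (d : nat) (a : 'M[C]_(d.+1, N)) : set 'M[C]_(d.+1, N) :=
  [set c *: a | c in [set c : C | c != 0]].

(* The set of the morphisms f : P^1 -> OG of degree d such that f(0), f(1) and
   f(oo) lie in X1, X2 and X3, a morphism being the class of its matrices. *)
Definition curves_meeting (d : nat) (X1 X2 X3 : set 'rV[C]_N) :
    set (set 'M[C]_(d.+1, N)) :=
  [set same_curve a | a in [set a | [/\ is_curve a, X1 (curve_eval a 1 0),
                            X2 (curve_eval a 1 1) & X3 (curve_eval a 0 1)]]].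
Arguments curves_meeting : clear implicits.

(* P holds on a nonempty Zariski open subset of SO x SO x SO, which is an
   irreducible variety; f is a polynomial in the entries of g1, g2, g3. *)
Definition generic_SO3 (P : 'M[C]_N -> 'M[C]_N -> 'M[C]_N -> Prop) : Prop :=
  exists f : mpoly.mpoly (N * N + (N * N + N * N)) C,
  let value g1 g2 g3 := mpoly.meval
    (fun k => row_mx (mxvec g1) (row_mx (mxvec g2) (mxvec g3)) 0 k) f in
  (exists g1 g2 g3, [/\ SO g1, SO g2, SO g3 & value g1 g2 g3 != 0]) /\
  (forall g1 g2 g3, SO g1 -> SO g2 -> SO g3 -> value g1 g2 g3 != 0 ->
     P g1 g2 g3).

Definition is_curve_count (p i k d m : nat) : Prop :=
  generic_SO3 (fun g1 g2 g3 =>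
    curves_meeting d (translate g1 (schubert p)) (translate g2 (schubert i))
                     (translate g3 (schubert k)) #= `I_m).

(* The Gromov-Witten invariant <tau_p, tau_i, tau_k>_d. It is zero unless the
   codimensions add up to the dimension of the space of three-pointed rational
   curves of degree d, which is dim OG + \int_d c_1. *)
Definition gw (p i k d : nat) : nat :=
  if (p + i + k == dim_OG n + d * (2 * n - 1))%N
  then xget 0%N [set m | is_curve_count p i k d m] else 0%N.

End Geometry.

Section QuantumCohomology.
Variables (R : realType) (n : nat).
Local Notation C := R[i].

(* The free Z[q]-module with basis tau_0, ..., tau_(2n-1), where q is 'X. *)
Definition QH := 'rV[{poly int}]_(2 * n).

Definition tau (p : nat) : QH := \row_(j < 2 * n) ((j == p :> nat)%:R).

(* The coordinate of tau_p * tau_i on tau_j. By the degree condition in [gw],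
   an exponent d of q with a nonzero coefficient satisfies
   p + i = j + d (2n-1), so that d <= p + i and no term is dropped. *)
Definition structure_poly (p i j : nat) : {poly int} :=
  \poly_(d < (p + i).+1) (gw R n p i (2 * n - 1 - j) d)%:Z.

Definition qmul (x y : QH) : QH :=
  \row_(j < 2 * n) \sum_(p < 2 * n) \sum_(i < 2 * n)
     x 0 p * y 0 i * structure_poly p i j.

Definition quantum_chevalley : Prop :=
  [/\ forall p : nat, (p.+2 <= n)%N -> qmul (tau 1) (tau p) = tau p.+1,
      qmul (tau 1) (tau (n - 1)) = tau n *+ 2,
      forall p : nat, (n <= p)%N -> (p <= 2 * n - 3)%N ->
        qmul (tau 1) (tau p) = tau p.+1,
      qmul (tau 1) (tau (2 * n - 2)) = tau (2 * n - 1) + 'X *: tau 0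
    & qmul (tau 1) (tau (2 * n - 1)) = 'X *: tau 1].

(* -K_OG is 2n-1 times the hyperplane class, by adjunction in P^2n. *)
Definition c1 : QH := tau 1 *+ (2 * n - 1).

Definition at_q1 (x : QH) : 'rV[C]_(2 * n) :=
  map_mx (fun f : {poly int} => (f.[1])%:~R) x.

(* The matrix of y |-> (x * y)|_(q=1) in the basis tau, acting on row vectors
   on the right: its i-th row is the image of tau_i. *)
Definition A (x : QH) : 'M[C]_(2 * n) :=
  \matrix_(i < 2 * n) at_q1 (qmul x (tau i)).

Definition FPdim (x : QH) : R :=
  sup [set ComplexField.Normc.normc delta | delta in [set z | eigenvalue (A x) z]].

(* For n > 0 the supremum is a maximum. *)
Lemma FPdim_max (x : QH) : (0 < n)%N ->
  (exists2 z, eigenvalue (A x) z & FPdim x = ComplexField.Normc.normc z) /\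
  (forall z, eigenvalue (A x) z -> ComplexField.Normc.normc z <= FPdim x).
Proof.
move=> n0; pose nm := @ComplexField.Normc.normc R.
have [r Er] := closed_field_poly_normal (char_poly (A x)).
have mr z : eigenvalue (A x) z = (z \in r).
  rewrite eigenvalue_root_char Er (monicP (char_poly_monic _)) scale1r.
  by rewrite root_prod_XsubC.
have sr : (0 < size r)%N.
  have := size_char_poly (A x).
  rewrite Er (monicP (char_poly_monic _)) scale1r size_prod_XsubC => -[->].
  by rewrite muln_gt0.
have [z zr zm] : exists2 z, z \in r & forall y, y \in r -> nm y <= nm z.
  elim: r sr {Er mr} => // a [|b s] IH _.
    by exists a => [|y]; rewrite inE // => /eqP ->.
  have [//|z zs zm] := IH.
  have [az|za] := leP (nm a) (nm z).
    exists z; first by rewrite inE zs orbT.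
    by move=> y; rewrite inE => /orP[/eqP ->|/zm].
  exists a; first by rewrite inE eqxx.
  move=> y; rewrite inE => /orP[/eqP -> //|/zm yz].
  exact: le_trans yz (ltW za).
have FE : FPdim x = nm z.
  apply/eqP; rewrite eq_le; apply/andP; split.
    apply: ge_sup; first by exists (nm z), z => //=; rewrite mr.
    by move=> _ [y /= + <-]; rewrite mr; exact: zm.
  apply: ub_le_sup; last by exists z => //=; rewrite mr.
  by exists (nm z) => _ [y /= + <-]; rewrite mr; exact: zm.
by split; [exists z; rewrite ?mr | move=> y; rewrite mr FE; exact: zm].
Qed.

End QuantumCohomology.

(* Main.v *)
Require Import Defs.
From mathcomp Require Import all_boot all_order all_algebra.
From mathcomp Require Import all_classical all_reals.
From mathcomp Require Import complex.
From mathcomp Require Import zify ring.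
Import Order.TTheory GRing.Theory Num.Theory.
Local Open Scope ring_scope.

(** By the Chevalley formula at q = 1, multiplication by tau_1 is an explicit
    matrix of size 2n, nearly a cyclic shift: its characteristic polynomial is
    z (z^(2n-1) - 4).  Hence every complex root z of z^(2n-1) = 4 gives an
    eigenvalue (2n-1) z of multiplication by c_1; an eigenvector is
    tau_0 + z^(2n-2)/2 tau_1 + ... + z^n/2 tau_(n-1)
      + z^(n-1) tau_n + ... + z tau_(2n-2) + tau_(2n-1)
    ([eigenvalue_c1]).  All these eigenvalues have modulus
    (2n-1) 4^(1/(2n-1)), so the bound 2n amounts to
    (2n)^(2n-1) <= 4 (2n-1)^(2n-1), that is (1 + 1/m)^m <= 4 for m = 2n-1.
    As m + 1 = 2n is even, this follows from the Bernoulli inequality for the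
    exponent n ([exp_even_le_4exp_pred]). *)

Lemma bernoulli_sub (R : realDomainType) (t : R) (k : nat) :
  t <= 1 -> 1 - t *+ k <= (1 - t) ^+ k.
Proof.
move=> t1; elim: k => [|k IH]; first by rewrite mulr0n subr0 expr0.
have s0 : 0 <= 1 - t by rewrite subr_ge0.
rewrite exprS; apply: le_trans (ler_wpM2l s0 IH).
rewrite -subr_ge0; set d := (X in 0 <= X).
have -> : d = t ^+ 2 *+ k.
  rewrite /d -[t *+ k.+1]mulr_natr -[t *+ k]mulr_natr -[t ^+ 2 *+ k]mulr_natr.
  by rewrite -[k.+1]addn1 natrD; ring.
by rewrite mulrn_wge0 // sqr_ge0.
Qed.

(** Bernoulli gives (1 - 1/(2n))^n >= 1 - n/(2n) = 1/2; squaring,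
    (1 - 1/(2n))^(2n) >= 1/4, and one factor at most 1 can be dropped. *)
Lemma exp_even_le_4exp_pred (R : realFieldType) (n : nat) : (0 < n)%N ->
  (2 * n)%:R ^+ (2 * n - 1) <= 4 * (2 * n - 1)%:R ^+ (2 * n - 1) :> R.
Proof.
move=> n0; have N0 : 0 < (2 * n)%:R :> R by rewrite ltr0n muln_gt0.
have Nn0 : (2 * n)%:R != 0 :> R by rewrite gt_eqF.
have nn0 : n%:R != 0 :> R by rewrite pnatr_eq0 -lt0n.
pose t : R := (2 * n)%:R^-1.
have t0 : 0 <= t by rewrite invr_ge0 ltW.
have t1 : t <= 1 by rewrite invf_le1 // ler1n muln_gt0.
have s0 : 0 <= 1 - t by rewrite subr_ge0.
have s1 : 1 - t <= 1 by rewrite gerBl.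
have half : 2^-1 <= (1 - t) ^+ n.
  apply: le_trans (bernoulli_sub _ _ n t1).
  suff -> : 1 - t *+ n = 2^-1 by [].
  by rewrite /t -mulr_natr natrM; field.
have quarter : 4^-1 <= (1 - t) ^+ (2 * n - 1).
  apply: (@le_trans _ _ ((1 - t) ^+ (2 * n))); last first.
    by apply: ler_wiXn2l => //; exact: leq_subr.
  rewrite mulnC exprM; apply: le_trans (_ : 2^-1 ^+ 2 <= _).
    by rewrite exprVn -natrX.
  by rewrite lerXn2r // ?nnegrE ?exprn_ge0 // invr_ge0.
have -> : (2 * n - 1)%:R = (2 * n)%:R * (1 - t) :> R.
  by rewrite mulrBr mulr1 mulfV // natrB // muln_gt0.
rewrite exprMn mulrCA ler_peMr ?exprn_ge0 ?ler0n //.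
by rewrite -ler_pdivrMl ?ltr0n // mulr1.
Qed.

Lemma sum_ord_delta (V : pzSemiRingType) (N : nat) (f : nat -> V) (k : nat) :
  \sum_(i < N) f i * (i == k :> nat)%:R = if (k < N)%N then f k else 0.
Proof.
rewrite -(big_ord1_eq +%R) [RHS]big_mkcond; apply: eq_bigr => i _.
by case: eqP; rewrite ?mulr1 ?mulr0.
Qed.

Section Chevalley.
Variables (R : realType) (n : nat).
Local Notation C := R[i].

Lemma A_mulrn (x : QH n) (m : nat) : A R (x *+ m) = A R x *+ m.
Proof.
apply/matrixP => i j; rewrite mulmxnE !mxE -rmorphMn -hornerMn; congr (_.[1])%:~R.
rewrite -sumrMnl; apply: eq_bigr => p _; rewrite -sumrMnl; apply: eq_bigr => k _.
by rewrite mulmxnE !mulrnAl.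
Qed.

Lemma horner1_nat (k : nat) : (@horner int k%:R 1)%:~R = k%:R :> C.
Proof. by rewrite -polyC_natr hornerC rmorph_nat. Qed.

(** The first term shifts tau_i to tau_(i+1), doubled at i = n-1; it is zero in
    the row i = 2n-1, as j < 2n.  The other two are the quantum corrections
    q tau_0 and q tau_1, so that the five cases of the Chevalley formula become
    one expression that can be summed over i. *)
Lemma A_tau1E : (2 <= n)%N -> quantum_chevalley R n ->
  forall i j : 'I_(2 * n), A R (tau n 1) i j =
    (if i.+1 == n then 2 else 1) * (i.+1 == j)%:R
    + (i == (2 * n - 2)%N :> nat)%:R * (j == 0%N :> nat)%:R
    + (i == (2 * n - 1)%N :> nat)%:R * (j == 1%N :> nat)%:R.
Proof.
move=> n2 [c1 c2 c3 c4 c5] i j.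
have -> : A R (tau n 1) i j = ((qmul R (tau n 1) (tau n i) 0 j).[1])%:~R.
  by rewrite !mxE.
have i2 := ltn_ord i; have j2 := ltn_ord j.
have [h1|h1] := leqP (i.+2) n.
  have [-> -> ->] : [/\ (i.+1 == n) = false, (i == (2 * n - 2)%N :> nat) = false
      & (i == (2 * n - 1)%N :> nat) = false] by split; lia.
  by rewrite c1 // mxE horner1_nat !mul0r !addr0 mul1r eq_sym.
have [h2|h2] := eqVneq (i.+1) n.
  have [-> ->] : (i == (2 * n - 2)%N :> nat) = false
      /\ (i == (2 * n - 1)%N :> nat) = false by lia.
  have -> : nat_of_ord i = (n - 1)%N by lia.
  rewrite c2 mulmxnE mxE -mulrnA horner1_nat !mul0r !addr0.
  by rewrite natrM mulrC eq_sym; congr (_ * (_ == _)%:R); lia.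
have [h3|h3] := leqP i (2 * n - 3)%N.
  have [-> ->] : (i == (2 * n - 2)%N :> nat) = false
      /\ (i == (2 * n - 1)%N :> nat) = false by lia.
  rewrite c3 //; last by lia.
  by rewrite mxE horner1_nat !mul0r !addr0 mul1r eq_sym.
have [h4|h4] := eqVneq (nat_of_ord i) (2 * n - 2)%N.
  have -> : (i == (2 * n - 1)%N :> nat) = false by lia.
  rewrite h4 c4 !mxE hornerD hornerM hornerX mul1r rmorphD /= !horner1_nat.
  rewrite !mul0r !mul1r addr0; congr (_%:R + _); last exact: horner1_nat.
  by congr nat_of_bool; lia.
have h5 : nat_of_ord i = (2 * n - 1)%N by lia.
have -> : (i.+1 == j) = false by lia.
rewrite h5 c5 eqxx !mxE hornerM hornerX !mul1r mulr0n mul0r !add0r.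
exact: horner1_nat.
Qed.

(** The eigenvector equation says, for its coordinates v_p, that
    z v_(p+1) = v_p except for z v_n = 2 v_(n-1), z v_0 = v_(2n-2) and
    z v_1 = v_0 + v_(2n-1); the last equation is where z ^ (2n-1) = 4 enters. *)
Lemma eigenvalue_tau1 (z : C) : (2 <= n)%N -> quantum_chevalley R n ->
  z ^+ (2 * n - 1) = 4 -> eigenvalue (A R (tau n 1)) z.
Proof.
move=> n2 chev z4.
pose v (p : nat) : C :=
  if p == 0%N then 1 else
  if (p < n)%N then z ^+ (2 * n - 1 - p) / 2 else z ^+ (2 * n - 1 - p).
have n0 : (0 < 2 * n)%N by lia.
apply/eigenvalueP; exists (\row_(p < 2 * n) v p); last first.
  apply/eqP => /rowP/(_ (Ordinal n0)); rewrite !mxE /v eqxx => /eqP.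
  by rewrite oner_eq0.
apply/rowP => j; rewrite !mxE.
under eq_bigr => p _ do rewrite mxE (A_tau1E n2 chev) !mulrDr !mulrA.
rewrite !big_split /= -!mulr_suml !sum_ord_delta.
have -> : (2 * n - 2 < 2 * n)%N by lia.
have -> : (2 * n - 1 < 2 * n)%N by lia.
have v_penult : v (2 * n - 2)%N = z.
  rewrite /v; have [-> ->] : (2 * n - 2 == 0)%N = false
    /\ (2 * n - 2 < n)%N = false by lia.
  by have -> : (2 * n - 1 - (2 * n - 2) = 1)%N by lia.
have v_last : v (2 * n - 1)%N = 1.
  rewrite /v; have [-> ->] : (2 * n - 1 == 0)%N = false
    /\ (2 * n - 1 < n)%N = false by lia.
  by rewrite subnn.
rewrite v_penult v_last mul1r.
have two0 : 2 != 0 :> C by rewrite pnatr_eq0.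
(* Coordinate 0 receives only the correction q tau_0, coordinate 1 the shift
   and the correction q tau_1, all others only the shift. *)
case: j => [[|k] kN] /=.
  rewrite big1 => [|p _]; last by rewrite mulr0.
  by rewrite add0r addr0.
under eq_bigr => p _ do rewrite eqSS.
rewrite (sum_ord_delta _ _ (fun p => v p * (if p.+1 == n then 2 else 1))).
rewrite (ltnW kN) mulr0 addr0 eqSS.
have zS : z ^+ (2 * n - 1 - k) = z * z ^+ (2 * n - 1 - k.+1).
  by rewrite -exprS; congr (_ ^+ _); lia.
case: k kN zS => [|k] kN zS.
  have -> : (1 == n)%N = false by lia.
  by rewrite mulr1 /v /= n2 mulrA -zS subn0 z4; field.
rewrite [_ == 0%N]/= mulr0n addr0 /v /=.
have [e|ne] := eqVneq (k.+2) n.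
  have -> : (k.+1 < n)%N by lia.
  by rewrite -e ltnn e zS -mulrA mulVf // mulr1 -e.
rewrite mulr1; have [lt|ge] := ltnP (k.+2) n.
  by rewrite (ltnW lt) zS mulrA.
have -> : (k.+1 < n)%N = false by lia.
by rewrite zS.
Qed.

Lemma eigenvalue_c1 (z : C) : (2 <= n)%N -> quantum_chevalley R n ->
  z ^+ (2 * n - 1) = 4 -> eigenvalue (A R (c1 n)) (z *+ (2 * n - 1)).
Proof.
move=> n2 chev /(eigenvalue_tau1 _ n2 chev)/eigenvalueP[v vA v0].
apply/eigenvalueP; exists v => //.
by rewrite A_mulrn -scaler_nat -scalemxAr vA scalerA mulr_natl.
Qed.

End Chevalley.

Lemma normc_exp (R : rcfType) (z : R[i]) (k : nat) :
  ComplexField.Normc.normc (z ^+ k) = ComplexField.Normc.normc z ^+ k.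
Proof.
elim: k => [|k IH]; first by rewrite !expr0 ComplexField.Normc.normc1.
by rewrite !exprS ComplexField.Normc.normcM IH.
Qed.

Theorem theorem1p3 (R : realType) (n : nat) (hn : (2 <= n)%N)
  (hChevalley : quantum_chevalley R n) :
  ((dim_OG n).+1%:R : R) <= FPdim R (c1 n).
Proof.
have n0 : (0 < n)%N by lia.
have m0 : (0 < 2 * n - 1)%N by lia.
(* Any root would do: only the modulus of z enters. *)
pose z : R[i] := (2 * n - 1).-root 4.
have z4 : z ^+ (2 * n - 1) = 4 by rewrite rootCK.
have [_ /(_ _ (eigenvalue_c1 _ _ z hn hChevalley z4))] := FPdim_max R (c1 n) n0.
apply: le_trans; rewrite normcMn.
have -> : (dim_OG n).+1 = (2 * n)%N by rewrite /dim_OG; lia.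
have nz0 : 0 <= ComplexField.Normc.normc z.
  by case: (z) => a b; exact: sqrtr_ge0.
rewrite -(ler_pXn2r m0) ?nnegrE ?mulrn_wge0 ?ler0n //.
rewrite -[X in _ <= X ^+ _]mulr_natl exprMn -normc_exp z4.
have -> : ComplexField.Normc.normc (4 : R[i]) = 4.
  by rewrite normcMn ComplexField.Normc.normc1.
by rewrite mulrC; exact: exp_even_le_4exp_pred.
Qed.
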